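(* Let $X$ be a Hausdorff topological vector space over $\mathbb{R}$ or $\mathbb{C}$, $E$ an order complete Hausdorff topological vector lattice, $\Omega\subset X$ open, and $H$ a nonempty set of functions $X\to\overline{E}$. Let functions $F_i\colon\Omega\to E$, $i\in I=\{1,\ldots,n\}$, be weakly $H$-codifferentiable at a point $x\in\Omega$. Suppose that: (1) $H$ is closed under addition; (2) $-h\in H$ for every $h\in H$; (3) $H$ is closed under vertical shifts, i.e. $h+c\in H$ for all $c\in E$, $h\in H$. Then the functions $F=\sup_{i\in I}F_i$ and $G=\inf_{i\in I}F_i$ are weakly $H$-codifferentiable at $x$. Moreover, for any $(\Phi_i,\Psi_i)\in\delta(F_i)_H[x]$ and $(U_i,V_i)\in D^w_HF_i(x)$, $i\in I$, one has $$\delta F_H[x]=\Big[\sup_{i\in I}\Big(F_i(x)-F(x)+\Phi_i-\sum_{j\in I\setminus\{i\}}\Psi_j\Big),\ \sum_{k\in I}\Psi_k\Big]_w,$$ $$\delta G_H[x]=\Big[\sum_{k\in I}\Phi_k,\ \inf_{i\in I}\Big(F_i(x)-G(x)+\Psi_i-\sum_{j\in I\setminus\{i\}}\Phi_j\Big)\Big]_w,$$ and $$D^w_HF(x)=\Big[\bigcup_{i\in I}\Big\{\{F_i(x)-F(x)\}+U_i-\sum_{j\in I\setminus\{i\}}V_j\Big\},\ \sum_{k\in I}V_k\Big]_w,$$ $$D^w_HG(x)=\Big[\sum_{k\in I}U_k,\ \bigcup_{i\in I}\Big\{\{F_i(x)-G(x)\}+V_i-\sum_{j\in I\setminus\{i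\}}U_j\Big\}\Big]_w.$$
   Context: $\overline{E}=E\cup\{-\infty,+\infty\}$ with the improper elements as least and greatest elements and the usual rules $x+(\pm\infty)=\pm\infty$ for $x\in E$; the expression $+\infty+(-\infty)$ is not defined. For a function $f$ with values in $\overline E$, $\operatorname{dom}f$ is the set of points where $f$ takes values in $E$. The set $H$ is closed under addition if for any $h_1,h_2\in H$ the sum $h_1+h_2$ is well defined (i.e. nowhere of the form $+\infty+(-\infty)$ or $-\infty+\infty$) and belongs to $H$. Elements of $E$ are identified with constant functions; sums and differences of sets are Minkowski ones. $\sup_{i}F_i$, $\inf_iF_i$ are pointwise. A function $X\to\overline E$ is $H$-convex (resp. $H$-concave) if it is the pointwise supremum (resp. infimum) of a nonempty subset of $H$; it is said to be generated by that subset. $PF(X,\overline E,H)$ is the set of pairs $(\Phi,\Psi)$ with $\Phi$ $H$-convex, $\Psi$ $H$-concave, and $\operatorname{dom}\Phi\cap\operatorname{dom}\Psi$ containing a neighbourhood of $0$. The relation $\sigma_w$ on it: $(\Phi_1,\Psi_1)\,\sigma_w\,(\Phi_2,\Psi_2)$ iff $\Phi_1(0)+\Psi_1(0)=\Phi_2(0)+\Psi_2(0)$ and for every $v\in X$, $\frac1\alpha(\Phi_1(\alpha v)+\Psi_1(\alpha v)-\Phi_2(\alpha v)-\Psi_2(\alpha v))\to0$ as $\alpha\downarrow0$. The class of $(\Phi,\Psi)$ is $[\Phi,\Psi]_w$. For pairs $(U,V)$ of nonempty subsets of $H$ with $(\sup_{h\in U}h,\inf_{p\in V}p)\in PF(X,\overline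 E,H)$, $[U,V]_w$ is the class of $(U,V)$ under the relation ''the associated pairs $(\sup_Uh,\inf_Vp)$ are $\sigma_w$-equivalent''. A function $F\colon\Omega\to E$ is weakly $H$-codifferentiable at $x\in\Omega$ if there is $(\Phi,\Psi)\in PF(X,\overline E,H)$ with $\Phi(0)+\Psi(0)=0$ such that for every $\Delta x\in X$ with $\operatorname{co}\{x,x+\Delta x\}\subset\Omega$ and $\operatorname{co}\{0,\Delta x\}\subset\operatorname{dom}\Phi\cap\operatorname{dom}\Psi$ one has $F(x+\Delta x)-F(x)=\Phi(\Delta x)+\Psi(\Delta x)+o(\Delta x,x)$, where $o(\alpha\Delta x,x)/\alpha\to0$ as $\alpha\downarrow0$. The (unique) class $\delta F_H[x]=[\Phi,\Psi]_w$ is the weak $H$-derivative of $F$ at $x$. If $\Phi$ is generated by $U\subset H$ and $\Psi$ by $V\subset H$, then $D^w_HF(x)=[U,V]_w$ is the weak $H$-codifferential (independent of choices). *)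

(* Defs.v *)
From HB Require Import structures.
From mathcomp Require Import all_boot all_order all_algebra.
From mathcomp Require Import complex.
From mathcomp Require Import all_classical all_reals all_analysis.

Set Implicit Arguments.
Unset Strict Implicit.
Unset Printing Implicit Defensive.

Import Order.TTheory GRing.Theory Num.Theory.
Import numFieldNormedType.Exports.

Local Open Scope classical_set_scope.
Local Open Scope ring_scope.

Definition vabs (E : porderZmodType) (x : E) : E := supremum 0 [set x; - x].

Definition solid (E : porderZmodType) (A : set E) :=
  forall x y : E, A y -> vabs x <= vabs y -> A x.

(* A topological vector lattice: a real topological vector space that is a
   vector lattice and has a basis of neighbourhoods of 0 made of solid sets.
   Binary suprema and infima are properties rather than operations because the
   library has no structure joining [Order.Lattice] and [GRing.Zmodule].
   [topologicalLmodType] is a general topological vector space; [tvsType] would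
   add local convexity. *)
HB.mixin Record isTopologicalVectorLattice (R : realType) E
    & TopologicalLmodule R E & Num.POrderedZmodule E := {
  tvl_lerD2r : forall z x y : E, x <= y -> x + z <= y + z ;
  tvl_scaler_ge0 : forall (a : R) (x : E), 0 <= a -> 0 <= x -> 0 <= a *: x ;
  tvl_sup2 : forall x y : E, exists m, supremums [set x; y] m ;
  tvl_inf2 : forall x y : E, exists m, infimums [set x; y] m ;
  tvl_locally_solid : forall U : set E, nbhs (0 : E) U ->
    exists V : set E, [/\ nbhs (0 : E) V, solid V & V `<=` U]
}.

#[short(type="topologicalVectorLatticeType")]
HB.structure Definition TopologicalVectorLattice (R : realType) :=
  {E of isTopologicalVectorLattice R E & TopologicalLmodule R E
      & Num.POrderedZmodule E}.

Definition order_complete d (T : porderType d) :=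
  (forall A : set T, has_sup A -> exists m, supremums A m) /\
  (forall A : set T, has_inf A -> exists m, infimums A m).

Variant scalar_kind := RealScalars | ComplexScalars.

Definition scalars (R : realType) (k : scalar_kind) : numFieldType :=
  match k with
  | RealScalars => R
  | ComplexScalars => R[i]
  end.

Definition real_scalar (R : realType) (k : scalar_kind) : R -> scalars R k :=
  match k with
  | RealScalars => id
  | ComplexScalars => fun a => Complex a 0
  end.

Definition rscale (R : realType) (k : scalar_kind)
    (X : lmodType (scalars R k)) (a : R) (v : X) : X :=
  real_scalar k a *: v.

Definition segment (R : realType) (k : scalar_kind)
    (X : lmodType (scalars R k)) (u v : X) : set X :=
  [set rscale (1 - t) u + rscale t v | t in `[0, 1]].

(* The library orders [\bar E] only when E is a number domain. *)
Section ExtendedLattice.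
Context (R : realType) (E : topologicalVectorLatticeType R).

Definition ext_le (a b : \bar E) : bool :=
  match a, b with
  | -oo%E, _ => true
  | _, +oo%E => true
  | EFin r, EFin s => r <= s
  | _, _ => false
  end.

(* When E is order complete, every subset of [\bar E] has a least upper bound
   and a greatest lower bound, so the defaults of [xget] are not used. *)
Definition ext_sup (A : set (\bar E)) : \bar E :=
  xget +oo%E [set m | (forall a, A a -> ext_le a m) /\
    forall b, (forall a, A a -> ext_le a b) -> ext_le m b].

Definition ext_inf (A : set (\bar E)) : \bar E :=
  xget -oo%E [set m | (forall a, A a -> ext_le m a) /\
    forall b, (forall a, A a -> ext_le b a) -> ext_le b m].

(* The library's addition on [\bar E] is total ([+oo + -oo = -oo]); this says
   when the sum is not of that undefined form. *)
Definition add_defined (a b : \bar E) : Prop :=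
  ~ (a = +oo%E /\ b = -oo%E) /\ ~ (a = -oo%E /\ b = +oo%E).

End ExtendedLattice.

Section AbstractConvexity.
Context (R : realType) (k : scalar_kind).
Context (X : topologicalLmodType (scalars R k)).
Context (E : topologicalVectorLatticeType R).

Implicit Types (H U V : set (X -> \bar E)) (Phi Psi : X -> \bar E).
Implicit Types p q : (X -> \bar E) * (X -> \bar E).
Implicit Types P Q : set (X -> \bar E) * set (X -> \bar E).

Definition edom Phi : set X := [set v | exists e : E, Phi v = e%:E].

Definition psup U : X -> \bar E := fun v => ext_sup [set h v | h in U].
Definition pinf U : X -> \bar E := fun v => ext_inf [set h v | h in U].

Definition mink_add U V : set (X -> \bar E) :=
  [set f | exists h1 h2, [/\ U h1, V h2 & f = (h1 \+ h2)%E]].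
Definition mink_sub U V : set (X -> \bar E) :=
  [set f | exists h1 h2, [/\ U h1, V h2 & f = (h1 \- h2)%E]].
Definition mink_sum n (I : pred 'I_n) (W : 'I_n -> set (X -> \bar E)) :=
  \big[mink_add/[set cst 0%E]]_(j < n | I j) W j.

Definition closed_add H := forall h1 h2, H h1 -> H h2 ->
  (forall v, add_defined (h1 v) (h2 v)) /\ H (h1 \+ h2)%E.
Definition closed_opp H := forall h, H h -> H (\- h)%E.
Definition closed_shift H := forall (h : X -> \bar E) (c : E),
  H h -> H (fun v => h v + c%:E)%E.

Definition sup_generated H U Phi := [/\ U !=set0, U `<=` H & Phi = psup U].
Definition inf_generated H V Psi := [/\ V !=set0, V `<=` H & Psi = pinf V].
Definition Hconvex H Phi := exists U, sup_generated H U Phi.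
Definition Hconcave H Psi := exists V, inf_generated H V Psi.

Definition PF H p := [/\ Hconvex H p.1, Hconcave H p.2 &
  nbhs (0 : X) (edom p.1 `&` edom p.2)].

(* For pairs in [PF H], the argument of [fine] is finite for small [a]. *)
Definition sigma_w H p q := [/\ PF H p, PF H q,
  (p.1 0%R + p.2 0%R = q.1 0%R + q.2 0%R)%E &
  forall v : X,
    (fun a : R => a^-1 *: fine
       (p.1 (rscale a v) + p.2 (rscale a v)
          - q.1 (rscale a v) - q.2 (rscale a v))%E)
    @ 0^'+ --> (0 : E)].

Definition wclass H p : set ((X -> \bar E) * (X -> \bar E)) :=
  [set q | sigma_w H p q].

Definition admissible H P := [/\ P.1 !=set0, P.2 !=set0,
  P.1 `<=` H, P.2 `<=` H & PF H (psup P.1, pinf P.2)].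

Definition wclass_sets H P : set (set (X -> \bar E) * set (X -> \bar E)) :=
  [set Q | [/\ admissible H P, admissible H Q &
    sigma_w H (psup P.1, pinf P.2) (psup Q.1, pinf Q.2)]].

(* Functions on Omega are total functions on X of which only the values on
   Omega matter. *)
Definition wapprox (Omega : set X) H (F : X -> E) (x : X) p :=
  [/\ PF H p, (p.1 0%R + p.2 0%R = 0)%E &
  exists o : X -> E, forall dx : X,
    segment x (x + dx) `<=` Omega ->
    segment 0 dx `<=` edom p.1 `&` edom p.2 ->
    ((F (x + dx) - F x)%R%:E = p.1 dx + p.2 dx + (o dx)%:E)%E /\
    (fun a : R => a^-1 *: o (rscale a dx)) @ 0^'+ --> (0 : E)].

Definition wcodifferentiable (Omega : set X) H (F : X -> E) (x : X) :=
  exists p, wapprox Omega H F x p.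

(* [set0] if F is not weakly H-codifferentiable at x. *)
Definition wderivative (Omega : set X) H (F : X -> E) (x : X) :
    set ((X -> \bar E) * (X -> \bar E)) :=
  xget set0 [set C | exists p, wapprox Omega H F x p /\ C = wclass H p].

Definition wcodifferential (Omega : set X) H (F : X -> E) (x : X) :
    set (set (X -> \bar E) * set (X -> \bar E)) :=
  xget set0 [set C | exists Phi Psi U V,
    [/\ wderivative Omega H F x (Phi, Psi), sup_generated H U Phi,
        inf_generated H V Psi & C = wclass_sets H (U, V)]].

Definition fun_sup n (F_ : 'I_n -> X -> E) : X -> E :=
  fun y => supremum 0 (range (F_^~ y)).
Definition fun_inf n (F_ : 'I_n -> X -> E) : X -> E :=
  fun y => infimum 0 (range (F_^~ y)).

End AbstractConvexity.

(* Main.v *)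
(** Since [H] is closed under sums and [h - h] must be well defined, every
    element of [H] is finite valued. Hence generators behave like subsets of
    [E]: a supremum over a Minkowski sum is the sum of the suprema.

    The pair [(Phi, Psi)] is a weak derivative of [F] at [x] iff
    [F (x + a v) - F x - (Phi + Psi) (a v) = o(a)] for each direction [v];
    uniqueness of the class and its independence of generators follow by adding
    such expansions. The pair proposed for the supremum has the value
    [sup_i (F_i x + (Phi_i + Psi_i) v) - F x], because the sum of all the
    [Psi_j] can be moved inside the supremum. Since
    [|sup_i a_i - sup_i b_i| <= sum_i |a_i - b_i|] in a vector lattice and [E]
    is locally solid, the remainder for [F] is dominated by those of the [F_i].
    Infima are negatives of suprema. *)
Require Import Defs.
From HB Require Import structures.
From mathcomp Require Import all_boot all_order all_algebra.
From mathcomp Require Import complex.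
From mathcomp Require Import all_classical all_reals all_analysis.

Set Implicit Arguments.
Unset Strict Implicit.
Unset Printing Implicit Defensive.

Import Order.TTheory GRing.Theory Num.Theory.
Import numFieldNormedType.Exports.

Local Open Scope classical_set_scope.
Local Open Scope ring_scope.

(** * Suprema and infima in a partial order *)

Section SupremumInfimum.
Context d (T : porderType d).
Implicit Types (A : set T) (m x : T).

Lemma supremum_eq x A m : A !=set0 -> supremums A m -> supremum x A = m.
Proof.
move=> /set0P A0 Am; rewrite /supremum (negbTE A0).
by apply: (is_subset1_supremums _ Am); apply: xgetPex; exists m.
Qed.

Lemma infimum_eq x A m : A !=set0 -> infimums A m -> infimum x A = m.
Proof.
move=> /set0P A0 Am; rewrite /infimum (negbTE A0).
by apply: (is_subset1_infimums _ Am); apply: xgetPex; exists m.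
Qed.

End SupremumInfimum.

(** * Order and absolute value in a vector lattice *)

Section VectorLatticeOrder.
Context (R : realType) (E : topologicalVectorLatticeType R).
Implicit Types x y z a b c : E.

Lemma tvl_lerD a b x y : a <= b -> x <= y -> a + x <= b + y.
Proof.
move=> ab xy; apply: (le_trans (tvl_lerD2r x _ _ ab)).
by rewrite ![b + _]addrC; exact: tvl_lerD2r.
Qed.

Lemma tvl_lerBlDr x y z : (x - y <= z) = (x <= z + y).
Proof.
apply/idP/idP => [/(tvl_lerD2r y)|/(tvl_lerD2r (- y))].
  by rewrite subrK.
by rewrite addrK.
Qed.

Lemma tvl_lerN2 x y : (- x <= - y) = (y <= x).
Proof. by rewrite -[- x]add0r tvl_lerBlDr addrC -tvl_lerBlDr opprK add0r. Qed.

Lemma tvl_sum_ge0 (I : finType) (f : I -> E) (P : pred I) :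
  (forall i, 0 <= f i) -> 0 <= \sum_(i | P i) f i.
Proof.
move=> f0; elim/big_rec: _ => // i s _ s0.
by rewrite -[0]addr0; exact: tvl_lerD.
Qed.

Lemma tvl_le_sum (I : finType) (f : I -> E) (i : I) :
  (forall i, 0 <= f i) -> f i <= \sum_j f j.
Proof.
move=> f0; rewrite (bigD1 i) //= -[leLHS]addr0.
by apply: tvl_lerD => //; exact: tvl_sum_ge0.
Qed.

Lemma supremums_opp (A : set E) m :
  supremums [set - a | a in A] (- m) <-> infimums A m.
Proof.
split=> -[h1 h2]; split.
- by move=> a Aa; rewrite -tvl_lerN2; apply: h1; exists a.
- move=> b Ab; rewrite -tvl_lerN2; apply: h2 => _ [a Aa <-].
  by rewrite tvl_lerN2; exact: Ab.
- by move=> _ [a Aa <-]; rewrite tvl_lerN2; exact: h1.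
- move=> b Ab; rewrite -[b]opprK tvl_lerN2; apply: h2 => a Aa.
  by rewrite -tvl_lerN2 opprK; apply: Ab; exists a.
Qed.

(** The lattice axiom [tvl_sup2] provides a least upper bound, so the default [0] in the definition
    of [vabs] is never the reason for its value. *)
Lemma vabs_supremums x : supremums [set x; - x] (vabs x).
Proof.
have [m hm] := tvl_sup2 x (- x).
by rewrite /vabs (supremum_eq _ _ hm)//; exists x; left.
Qed.

Lemma ler_vabs x : x <= vabs x.
Proof. by have [+ _] := vabs_supremums x; apply; left. Qed.

Lemma lerN_vabs x : - x <= vabs x.
Proof. by have [+ _] := vabs_supremums x; apply; right. Qed.

Lemma vabs_le x b : x <= b -> - x <= b -> vabs x <= b.
Proof. by move=> xb nxb; have [_] := vabs_supremums x; apply=> _ [->|->]. Qed.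

(** Adding [x <= vabs x] and [- x <= vabs x] shows that twice [vabs x] is nonnegative, and scaling
    by one half preserves this. *)
Lemma vabs_ge0 x : 0 <= vabs x.
Proof.
have h : 0 <= vabs x + vabs x.
  by rewrite -(subrr x); apply: tvl_lerD; [exact: ler_vabs|exact: lerN_vabs].
have -> : vabs x = 2^-1 *: (vabs x + vabs x).
  rewrite scalerDr -scalerDl -[_ + _]/(2^-1 + 2^-1) -[2^-1]mul1r -splitr.
  by rewrite scale1r.
by apply: tvl_scaler_ge0 => //; rewrite invr_ge0.
Qed.

Lemma vabs_nneg x : 0 <= x -> vabs x = x.
Proof.
move=> x0; apply/eqP; rewrite eq_le ler_vabs andbT; apply: vabs_le => //.
by apply: (le_trans _ x0); rewrite -oppr0 tvl_lerN2.
Qed.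

Lemma vabsN x : vabs (- x) = vabs x.
Proof.
by apply/eqP; rewrite eq_le; apply/andP; split; apply: vabs_le;
  rewrite ?opprK ?lerN_vabs ?ler_vabs// -[leLHS]opprK lerN_vabs.
Qed.

Lemma tvl_ler_scale (r : R) x y : 0 <= r -> x <= y -> r *: x <= r *: y.
Proof.
move=> r0 xy; rewrite -[leLHS]addr0 addrC -[leRHS](subrK (r *: x)).
apply: tvl_lerD2r; rewrite -scalerBr; apply: tvl_scaler_ge0 => //.
by rewrite -(subrr x); exact: tvl_lerD2r.
Qed.

Lemma vabs_scale (r : R) x : 0 < r -> vabs (r *: x) = r *: vabs x.
Proof.
have le_scale (t : R) y : 0 < t -> vabs (t *: y) <= t *: vabs y.
  by move=> t0; apply: vabs_le; rewrite -?scalerN; apply: tvl_ler_scale;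
    rewrite ?ler_vabs ?lerN_vabs// ltW.
move=> r0; apply/eqP; rewrite eq_le le_scale//=.
(* The reverse inequality is [le_scale] for the scalar [r^-1] and the vector [r *: x], multiplied by
   [r]. *)
rewrite -[x in leLHS](scalerK (lt0r_neq0 r0)) -[leRHS](scalerKV (lt0r_neq0 r0)).
by apply: tvl_ler_scale; [exact: ltW|rewrite le_scale// invr_gt0].
Qed.

End VectorLatticeOrder.

(** * Suprema of finite nonempty families *)

Section FiniteSuprema.
Context (R : realType) (E : topologicalVectorLatticeType R).
Context (n : nat) (n_gt0 : (0 < n)%N) (hEc : order_complete E).
Implicit Types f g : 'I_n -> E.

Lemma range_ord_nonempty T (f : 'I_n -> T) : range f !=set0.
Proof. by exists (f (Ordinal n_gt0)), (Ordinal n_gt0). Qed.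

Lemma supremum_rangeP f : supremums (range f) (supremum 0 (range f)).
Proof.
have [|m hm] := hEc.1 (range f).
  split; first exact: range_ord_nonempty.
  (* The sum of the absolute values dominates every member of the family, so order completeness
     applies. *)
  exists (\sum_i vabs (f i)) => _ [i _ <-].
  apply: le_trans (ler_vabs _) _.
  by apply: (@tvl_le_sum _ _ _ (fun j => vabs (f j)) i) => j; exact: vabs_ge0.
by rewrite (supremum_eq _ _ hm)//; exact: range_ord_nonempty.
Qed.

Lemma le_supremum_range f i : f i <= supremum 0 (range f).
Proof. by have [+ _] := supremum_rangeP f; apply; exists i. Qed.

Lemma supremum_range_le f b :
  (forall i, f i <= b) -> supremum 0 (range f) <= b.
Proof. by move=> fb; have [_] := supremum_rangeP f; apply=> _ [i _ <-]. Qed.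

Lemma supremum_range_shift f c :
  supremum 0 (range (fun i => f i + c)) = supremum 0 (range f) + c.
Proof.
apply: supremum_eq; first exact: range_ord_nonempty.
split=> [_ [i _ <-]|b hb]; first exact/tvl_lerD2r/le_supremum_range.
rewrite -[c]opprK tvl_lerBlDr; apply: supremum_range_le => i.
by rewrite -tvl_lerBlDr opprK; apply: hb; exists i.
Qed.

Lemma infimum_rangeN f :
  infimum 0 (range f) = - supremum 0 (range (fun i => - f i)).
Proof.
apply: infimum_eq; first exact: range_ord_nonempty.
apply/supremums_opp; rewrite opprK image_comp; exact: supremum_rangeP.
Qed.

(** Each [f i] equals [g i] plus [f i - g i], hence is at most the supremum of [g] plus the whole
    sum of absolute values. Exchanging [f] and [g] bounds the opposite difference. *)
Lemma vabs_supremum_rangeB f g :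
  vabs (supremum 0 (range f) - supremum 0 (range g))
    <= \sum_i vabs (f i - g i).
Proof.
have leS (f1 f2 : 'I_n -> E) :
    supremum 0 (range f1) - supremum 0 (range f2) <= \sum_i vabs (f1 i - f2 i).
  rewrite tvl_lerBlDr; apply: supremum_range_le => i.
  rewrite -[f1 i](subrK (f2 i)); apply: tvl_lerD (le_supremum_range _ _).
  apply: le_trans (ler_vabs _) _.
  apply: (@tvl_le_sum _ _ _ (fun j => vabs (f1 j - f2 j)) i) => j.
  exact: vabs_ge0.
apply: vabs_le; first exact: leS.
rewrite opprB; under eq_bigr do rewrite -vabsN opprB; exact: leS.
Qed.

End FiniteSuprema.

(** * Limits in a locally solid topological vector lattice *)

Section Limits.
Context (R : realType) (E : topologicalVectorLatticeType R).
Context (T : Type) (F : set_system T) {FF : Filter F}.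
Implicit Types f g : T -> E.

Lemma tvl_cvgD f g a b :
  f @ F --> a -> g @ F --> b -> (fun t => f t + g t) @ F --> a + b.
Proof.
by move=> fa gb; apply: continuous2_cvg fa gb; exact: (add_continuous (a, b)).
Qed.

Lemma tvl_cvgZ f (c : R) a : f @ F --> a -> (fun t => c *: f t) @ F --> c *: a.
Proof.
move=> fa; have cc : (fun=> c : R^o) @ F --> (c : R^o) by exact: cvg_cst.
apply: (continuous2_cvg (h := fun (z : R^o) (w : E) => z *: w) _ _ cc fa).
exact: (scale_continuous (c, a)).
Qed.

Lemma tvl_cvg_sum (I : finType) (f : I -> T -> E) :
  (forall i, f i @ F --> (0 : E)) -> (fun t => \sum_i f i t) @ F --> (0 : E).
Proof.
move=> f0; elim: (index_enum I) => [|i s IH].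
  by under eq_fun do rewrite big_nil; exact: cvg_cst.
under eq_fun do rewrite big_cons.
by move: (tvl_cvgD (f0 i) IH); rewrite addr0.
Qed.

(** Every neighbourhood of 0 contains a solid one, and a solid set that contains [g t] also contains
    each element of smaller absolute value. *)
Lemma tvl_squeeze f g : (\forall t \near F, vabs (f t) <= vabs (g t)) ->
  g @ F --> (0 : E) -> f @ F --> (0 : E).
Proof.
move=> fg g0 A /tvl_locally_solid [V [V0 sV VA]].
have gV : F (g @^-1` V) by apply: g0.
by apply: filterS2 fg gV => t tfg gt; apply: VA; exact: (sV _ _ gt tfg).
Qed.

Lemma tvl_cvg_vabs f : f @ F --> (0 : E) -> (fun t => vabs (f t)) @ F --> (0 : E).
Proof.
apply: tvl_squeeze; apply: nearW => t /=.
by rewrite (vabs_nneg (vabs_ge0 _)).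
Qed.

End Limits.

(** * Order, addition and suprema in the extended lattice *)

Section ExtendedOrder.
Context (R : realType) (E : topologicalVectorLatticeType R).
Implicit Types (a b c m : \bar E) (A B : set (\bar E)).

Definition ext_lub A m := (forall a, A a -> ext_le a m) /\
  forall b, (forall a, A a -> ext_le a b) -> ext_le m b.

Lemma ext_le_refl a : ext_le a a.
Proof. by case: a => /=. Qed.

Lemma ext_le_trans b a c : ext_le a b -> ext_le b c -> ext_le a c.
Proof. by case: a b c => [a||] [b||] [c||] //=; exact: le_trans. Qed.

Lemma ext_le_anti a b : ext_le a b -> ext_le b a -> a = b.
Proof.
case: a b => [a||] [b||] //= ab ba; congr (_%:E).
by apply/eqP; rewrite eq_le ab ba.
Qed.

Lemma ext_lub_unique A m m' : ext_lub A m -> ext_lub A m' -> m = m'.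
Proof.
by move=> [ub1 le1] [ub2 le2]; apply: ext_le_anti; [exact: le1|exact: le2].
Qed.

Lemma ext_sup_eq A m : ext_lub A m -> ext_sup A = m.
Proof.
by move=> Am; apply: (ext_lub_unique _ Am);
  apply: (@xgetPex _ _ (ext_lub A)); exists m.
Qed.

Lemma ext_sup_eq1 a : ext_sup [set a] = a.
Proof. by apply: ext_sup_eq; split=> [_ ->|b]; [exact: ext_le_refl|exact]. Qed.

Lemma ext_oppK : involutive (@oppe E).
Proof. by case=> [a||] //=; rewrite opprK. Qed.

Lemma ext_leN2 a b : ext_le (- a)%E (- b)%E = ext_le b a.
Proof. by case: a b => [a||] [b||] //=; exact: tvl_lerN2. Qed.

Lemma ext_leNr a b : ext_le a (- b)%E = ext_le b (- a)%E.
Proof. by rewrite -[in LHS](ext_oppK a) ext_leN2. Qed.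

Lemma ext_leNl a b : ext_le (- a)%E b = ext_le (- b)%E a.
Proof. by rewrite -[in LHS](ext_oppK b) ext_leN2. Qed.

(** The total addition sends both sums of opposite infinities to [-oo], and there the identity
    fails. Excluding [-oo] from both arguments rules this out. *)
Lemma ext_oppD a b : a != -oo%E -> b != -oo%E -> (- (a + b) = - a - b)%E.
Proof. by case: a b => [a||] [b||] //= _ _; rewrite /adde /= opprD. Qed.

Lemma ext_leD a b c m : ext_le a c -> ext_le b m -> ext_le (a + b)%E (c + m)%E.
Proof. by case: a b c m => [a||] [b||] [c||] [m||] //=; exact: tvl_lerD. Qed.

Lemma ext_addC a b : (a + b = b + a)%E.
Proof. by case: a b => [a||] [b||] //=; rewrite /adde /= addrC. Qed.

Lemma ext_le_addl (x : E) b c :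
  ext_le (x%:E + b)%E c = ext_le b (c - x%:E)%E.
Proof.
case: b c => [b||] [c||] //=.
by rewrite -[x]opprK addrC tvl_lerBlDr opprK.
Qed.

Lemma ext_sum_fin (I : finType) (P : pred I) (f : I -> \bar E) (g : I -> E) :
  (forall i, f i = (g i)%:E) ->
  (\sum_(i | P i) f i)%E = (\sum_(i | P i) g i)%:E.
Proof.
move=> fg; apply: (big_rec2 (fun x y => x = y%:E)) => // i y1 y2 _ ->.
by rewrite fg.
Qed.

Section OrderComplete.
Hypothesis hEc : order_complete E.

(** Four cases: [A] contains [+oo], with supremum [+oo]; [A] has no finite element, with supremum
    [-oo]; the finite part [B] is nonempty and bounded, where order completeness gives a finite
    supremum; [B] is unbounded, with supremum [+oo]. *)
Lemma ext_supP A : ext_lub A (ext_sup A).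
Proof.
suff [m hm] : exists m, ext_lub A m by rewrite (ext_sup_eq hm).
have [Apoo|Apoo] := pselect (A +oo%E).
  by exists +oo%E; split=> [[]//|b /(_ _ Apoo)].
pose B := [set x : E | A x%:E].
have [B0|B0] := pselect (B !=set0); last first.
  exists -oo%E; split=> // -[a Aa||] //.
  by exfalso; apply: B0; exists a.
have [[u Bu]|ubB] := pselect (has_ubound B).
  have [m [Bm mB]] := hEc.1 B (conj B0 (ex_intro _ u Bu)).
  exists m%:E; split=> [[a Aa||]//|[b Ab||]//]; first exact: Bm.
    by apply: mB => a; exact: Ab.
  by have [x Bx] := B0; move=> /(_ _ Bx).
exists +oo%E; split=> [[]//|[b Ab|//|]].
  by exfalso; apply: ubB; exists b => a; exact: Ab.
by have [x Bx] := B0; move=> /(_ _ Bx).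
Qed.

Lemma ext_sup_ub A a : A a -> ext_le a (ext_sup A).
Proof. exact: (ext_supP A).1. Qed.

Lemma ext_sup_le A b : (forall a, A a -> ext_le a b) -> ext_le (ext_sup A) b.
Proof. exact: (ext_supP A).2. Qed.

(** Negation reverses the extended order, so the negated supremum is a greatest lower bound, and
    antisymmetry identifies it with the chosen one. Facts on infima can then be read off from
    suprema. *)
Lemma ext_infN A : ext_inf A = (- ext_sup [set - a | a in A])%E.
Proof.
rewrite /ext_inf; set G := [set m | _]; set s := ext_sup _.
have Gs : G (- s)%E.
  split=> [a Aa|b hb]; first by rewrite ext_leNl; apply: ext_sup_ub; exists a.
  rewrite ext_leNr; apply: ext_sup_le => _ [a Aa <-].
  by rewrite ext_leN2; exact: hb.
have [h1 h2] := xgetPex -oo%E (ex_intro _ _ Gs).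
by apply: ext_le_anti; [apply: Gs.2|apply: h2 => a; exact: Gs.1].
Qed.

Lemma ext_sup_gtNy A : A !=set0 -> (forall a, A a -> exists x : E, a = x%:E) ->
  ext_sup A != -oo%E.
Proof.
move=> [a Aa] /(_ a Aa)[x ax]; apply/eqP => sA.
by have := ext_sup_ub Aa; rewrite sA ax.
Qed.

Lemma ext_supD A B : A !=set0 -> B !=set0 ->
  (forall a, A a -> exists x : E, a = x%:E) ->
  (forall b, B b -> exists x : E, b = x%:E) ->
  ext_sup [set a + b | a in A & b in B]%E = (ext_sup A + ext_sup B)%E.
Proof.
move=> A0 B0 finA finB; apply: ext_sup_eq; split=> [_ [a Aa [b Bb <-]]|c hc].
  by apply: ext_leD; exact: ext_sup_ub.
(* With [a] fixed and finite, it can be moved to the other side and the supremum taken over [B]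
   alone. *)
have aBc a : A a -> ext_le (a + ext_sup B)%E c.
  move=> Aa; have [x ax] := finA a Aa; rewrite ax ext_le_addl.
  apply: ext_sup_le => b Bb; rewrite -ext_le_addl -ax; apply: hc.
  by exists a => //; exists b.
(* The supremum of [B] is not [-oo]. If it is finite, it is moved across in turn and the supremum is
   taken over [A]. *)
move: (ext_sup_gtNy B0 finB) aBc; case: (ext_sup B) => [l||//] _ aBc.
  rewrite ext_addC ext_le_addl; apply: ext_sup_le => a Aa.
  by rewrite -ext_le_addl ext_addC; exact: aBc.
(* If the supremum of [B] is [+oo], a single element of [A] forces the upper bound [c] to be
   [+oo]. *)
have [a Aa] := A0; have [x ax] := finA a Aa.
by move: (aBc a Aa); rewrite ax; case: c {hc aBc} => //; case: ext_sup.
Qed.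

Lemma ext_sup_bigcup I (A : I -> set (\bar E)) :
  ext_sup (\bigcup_i A i) = ext_sup (range (fun i => ext_sup (A i))).
Proof.
apply: ext_sup_eq; split=> [a [i _ Aa]|b hb].
  by apply: (ext_le_trans (ext_sup_ub Aa)); apply: ext_sup_ub; exists i.
apply: ext_sup_le => _ [i _ <-]; apply: ext_sup_le => a Aa.
by apply: hb; exists i.
Qed.

Lemma ext_sup_range_fin n (n_gt0 : (0 < n)%N) (f : 'I_n -> E) :
  ext_sup (range (fun i => (f i)%:E)) = (supremum 0 (range f))%:E.
Proof.
apply: ext_sup_eq; split=> [_ [i _ <-]|[b||] hb] //=.
- exact: le_supremum_range.
- by apply: supremum_range_le => // i; apply: (hb (f i)%:E); exists i.
- by have := hb _ (ex_intro2 _ _ (Ordinal n_gt0) I erefl).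
Qed.

End OrderComplete.
End ExtendedOrder.

(** * Real multiples and segments in a real or complex space *)

Section RealScaling.
Context (R : realType) (k : scalar_kind).
Context (X : topologicalLmodType (scalars R k)).
Implicit Types (v x : X) (a b : R).

Lemma real_scalarD a b :
  real_scalar k (a + b) = real_scalar k a + real_scalar k b.
Proof. by case: k => //=; exact: (rmorphD (real_complex R)). Qed.

Lemma real_scalarM a b :
  real_scalar k (a * b) = real_scalar k a * real_scalar k b.
Proof. by case: k => //=; exact: (rmorphM (real_complex R)). Qed.

Lemma real_scalar1 : real_scalar k (1 : R) = 1.
Proof. by case: k. Qed.

Lemma rscaleA a b v : rscale a (rscale b v) = rscale (a * b) v.
Proof. by rewrite /rscale scalerA real_scalarM. Qed.

Lemma rscaleDl a b v : rscale (a + b) v = rscale a v + rscale b v.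
Proof. by rewrite /rscale real_scalarD scalerDl. Qed.

Lemma rscaleDr a v x : rscale a (v + x) = rscale a v + rscale a x.
Proof. by rewrite /rscale scalerDr. Qed.

Lemma rscale1 v : rscale 1 v = v.
Proof. by rewrite /rscale real_scalar1 scale1r. Qed.

Lemma real_scalar_cvg0 : real_scalar k @ (0 : R) --> (0 : (scalars R k)^o).
Proof.
case: k => /=; first exact: cvg_id.
apply/(cvgr0Pnorm_lt (V := R[i]^o)) => e e0.
(* In [R[i]] the relation [0 < e] forces [e] to be real, so its real part can serve as the
   radius. *)
have Ime0 : complex.Im e = 0 by move: e0; rewrite ltcE => /andP[/eqP].
have Ree0 : 0 < complex.Re e by move: e0; rewrite ltcE => /andP[].
apply/nbhs_ballP; exists (complex.Re e) => //= a; rewrite /ball /= sub0r normrN.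
rewrite normc_def /= expr0n /= addr0 sqrtr_sqr => ae.
by rewrite ltcE /= Ime0 eqxx.
Qed.

Lemma rscale_cvg0 v : (fun a => rscale a v) @ (0 : R) --> (0 : X).
Proof.
have cc : (fun=> v) @ (0 : R) --> v by exact: cvg_cst.
have := continuous2_cvg (h := fun (z : (scalars R k)^o) (w : X) => z *: w)
  _ _ real_scalar_cvg0 cc.
rewrite scale0r; apply.
by have := scale_continuous (0 : (scalars R k)^o, v); rewrite /continuous_at /= scale0r.
Qed.

Lemma segment_scaleE x v y :
  segment x (x + v) y <-> exists2 t, t \in `[0, 1] & y = x + rscale t v.
Proof.
have E t : rscale (1 - t) x + rscale t (x + v) = x + rscale t v.
  by rewrite rscaleDr addrA -rscaleDl subrK rscale1.
by split=> [[t t01 <-]|[t t01 ->]]; exists t; rewrite ?E.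
Qed.

Lemma segment_end x v : segment x (x + v) (x + v).
Proof.
by apply/segment_scaleE; exists 1; rewrite ?rscale1// in_itv /= ler01 lexx.
Qed.

Lemma sub_segment x v a : 0 <= a <= 1 ->
  segment x (x + rscale a v) `<=` segment x (x + v).
Proof.
move=> /andP[a0 a1] y /segment_scaleE[t t01 ->]; apply/segment_scaleE.
exists (t * a); last by rewrite rscaleA.
move: t01; rewrite !in_itv /= => /andP[t0 t1].
by rewrite mulr_ge0//= mulr_ile1.
Qed.

Lemma near_rscale (A : set X) x v : nbhs x A ->
  \forall a \near (0 : R), A (x + rscale a v).
Proof.
have cc : (fun=> x) @ (0 : R) --> x by exact: cvg_cst.
have := continuous2_cvg (h := fun (z : X) (w : X) => z + w)
  _ _ cc (rscale_cvg0 v).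
rewrite addr0 => h xA; apply: (h _ _ _ xA).
by have := add_continuous (x, 0 : X); rewrite /continuous_at /= addr0.
Qed.

(** If [x + a v] lies in [A] for all real [a] in a ball around 0, the same ball contains [t * a] for
    [t] in [[0, 1]]. One radius for the endpoint thus serves the whole segment. *)
Lemma near_segment (A : set X) x v : nbhs x A ->
  \forall a \near (0 : R)^'+, segment x (x + rscale a v) `<=` A.
Proof.
move=> /(near_rscale v) /nbhs_ballP[e /= e0 he].
apply/nbhs_ballP; exists e => //= a; rewrite /ball /= sub0r normrN => ae a0.
move=> y /segment_scaleE[t]; rewrite in_itv /= => /andP[t0 t1] ->.
rewrite rscaleA; apply: he; rewrite /ball /= sub0r normrN normrM.
by apply: le_lt_trans ae; rewrite ler_piMl// ger0_norm.
Qed.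

End RealScaling.

(** * Change of scale in right limits at 0 *)

Section RightLimits.
Context (R : realType) (E : topologicalVectorLatticeType R).

(** Carries a first-order estimate from a shortened direction [b v] back to [v]: substitute [a / b]
    for [a] and let the factor [b^-1] absorb the change of scale. *)
Lemma cvg_right0_rescale (f : R -> E) (b : R) : 0 < b ->
  (fun a => a^-1 *: f (a * b)) @ 0^'+ --> (0 : E) ->
  (fun a => a^-1 *: f a) @ 0^'+ --> (0 : E).
Proof.
move=> b0 /(tvl_cvgZ (c := b^-1)); rewrite scaler0 => h.
have hb : (fun a => a / b) @ (0 : R)^'+ --> (0 : R)^'+.
  move=> A /nbhs_ballP[e /= e0 eA]; apply/nbhs_ballP.
  exists (e * b) => /=; first exact: mulr_gt0.
  move=> a; rewrite /ball /= sub0r normrN => ae a0; apply: eA; last exact: divr_gt0.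
  by rewrite /ball /= sub0r normrN normf_div (gtr0_norm b0) ltr_pdivrMr.
have -> : (fun a => a^-1 *: f a) =
    (fun a => b^-1 *: (a^-1 *: f (a * b))) \o (fun a => a / b).
  apply/funext => a /=; rewrite divfK ?gt_eqF// invf_div scalerA mulrA.
  by rewrite mulVf ?mul1r// gt_eqF.
exact: cvg_comp hb h.
Qed.

End RightLimits.

(** * First-order expansions along rays *)

Section DirectionalApproximation.
Context (R : realType) (k : scalar_kind).
Context (X : topologicalLmodType (scalars R k)).
Context (E : topologicalVectorLatticeType R).
Implicit Types (F G g : X -> E) (x v : X).

(** The core of weak approximation, freed of segments and improper values: an [E]-valued model [g]
    of the increment of [F], with error [o(a)] along every ray. *)
Definition dir_approx F x g := forall v,
  (fun a : R => a^-1 *: (F (x + rscale a v) - F x - g (rscale a v)))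
  @ 0^'+ --> (0 : E).

Lemma near_eq_cvg0 (f g : R -> E) : (\forall a \near (0 : R)^'+, f a = g a) ->
  f @ 0^'+ --> (0 : E) -> g @ 0^'+ --> (0 : E).
Proof. by move=> fg; apply: cvg_trans; apply: near_eq_cvg. Qed.

Lemma dir_approxN F x g : dir_approx F x g ->
  dir_approx (fun y => - F y) x (fun v => - g v).
Proof.
move=> Fg v; have := tvl_cvgZ (c := -1) (Fg v); rewrite scaler0.
move=> h; apply: near_eq_cvg0 (h _); apply: nearW => a.
rewrite scalerA mulrC -scalerA scaleN1r !opprB !opprK.
by congr (_ *: _); rewrite [RHS]addrC [- _ + _]addrC.
Qed.

(** Since [rscale a v] tends to 0, only the germ of the model at 0 matters. Formulas valid where all
    functions are finite may therefore be substituted. *)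
Lemma dir_approx_near F x g g' :
  (\forall v \near (0 : X), g v = g' v) -> dir_approx F x g -> dir_approx F x g'.
Proof.
move=> gg' Fg v; apply: near_eq_cvg0 (Fg v).
apply: cvg_within; apply: filterS (near_rscale v gg') => a.
by rewrite add0r => ->.
Qed.

Lemma dir_approx_sup n (F_ g_ : 'I_n -> X -> E) x : (0 < n)%N -> order_complete E ->
  (forall i, dir_approx (F_ i) x (g_ i)) ->
  dir_approx (fun_sup F_) x
    (fun v => supremum 0 (range (fun i => F_ i x + g_ i v)) - fun_sup F_ x).
Proof.
move=> n0 hEc hF v.
pose o i a := a^-1 *: (F_ i (x + rscale a v) - F_ i x - g_ i (rscale a v)).
have : (fun a => \sum_i vabs (o i a)) @ (0 : R)^'+ --> (0 : E).
  by apply: tvl_cvg_sum => i; apply: tvl_cvg_vabs; exact: hF.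
apply: tvl_squeeze; near=> a.
have a0 : 0 < a by near: a; exact: nbhs_right_gt.
(* The two copies of [fun_sup F_ x] cancel. What remains is a difference of two finite suprema, to
   be bounded by the sum of the remainders. *)
rewrite opprB addrA subrK (vabs_nneg (tvl_sum_ge0 _ _)); last first.
  by move=> i; exact: vabs_ge0.
rewrite vabs_scale ?invr_gt0//.
under eq_bigr do rewrite vabs_scale ?invr_gt0//.
rewrite -scaler_sumr; apply: tvl_ler_scale; first by rewrite invr_ge0 ltW.
under eq_bigr do rewrite -addrA -opprD.
exact: vabs_supremum_rangeB.
Unshelve. all: by end_near. Qed.

Lemma dir_approx_inf n (F_ g_ : 'I_n -> X -> E) x : (0 < n)%N -> order_complete E ->
  (forall i, dir_approx (F_ i) x (g_ i)) ->
  dir_approx (fun_inf F_) x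
    (fun v => infimum 0 (range (fun i => F_ i x + g_ i v)) - fun_inf F_ x).
Proof.
move=> n0 hEc hF.
have := dir_approxN (dir_approx_sup n0 hEc (fun i => dir_approxN (hF i))).
congr dir_approx; apply/funext => y; rewrite ?opprB /fun_inf /fun_sup ?infimum_rangeN//.
rewrite opprK addrC; congr (- _ + _).
by under eq_fun do rewrite -opprD.
Qed.

End DirectionalApproximation.

(** * Equivalence classes, weak derivatives and codifferentials *)

Section WeakDerivative.
Context (R : realType) (k : scalar_kind).
Context (X : topologicalLmodType (scalars R k)).
Context (E : topologicalVectorLatticeType R).
Implicit Types (H : set (X -> \bar E)) (p q r : (X -> \bar E) * (X -> \bar E)).
Implicit Types (P Q : set (X -> \bar E) * set (X -> \bar E)).

(** Since [fine] gives 0 at improper values, this is the intended sum on the common domain, which is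
    a neighbourhood of 0 for pairs in [PF H]. *)
Definition pair_val p v : E := fine (p.1 v + p.2 v)%E.

Lemma pair_valE p v : (edom p.1 `&` edom p.2) v ->
  (p.1 v + p.2 v)%E = (pair_val p v)%:E.
Proof. by case=> -[a pa] [b pb]; rewrite /pair_val pa pb. Qed.

Lemma sigma_wE H p q v : PF H p -> PF H q ->
  \forall a \near (0 : R)^'+,
    fine (p.1 (rscale a v) + p.2 (rscale a v)
          - q.1 (rscale a v) - q.2 (rscale a v))%E
    = pair_val p (rscale a v) - pair_val q (rscale a v).
Proof.
move=> [_ _ p0] [_ _ q0].
apply: cvg_within; apply: filterS2 (near_rscale v p0) (near_rscale v q0) => a.
rewrite add0r => -[[p1 pE1] [p2 pE2]] [[q1 qE1] [q2 qE2]].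
by rewrite /pair_val pE1 pE2 qE1 qE2 /= opprD addrA.
Qed.

(** Near 0 all four values are finite, so the relation becomes one between differences in [E].
    Symmetry and transitivity then reduce to scaling and adding limits. *)
Lemma sigma_wP H p q : sigma_w H p q <->
  [/\ PF H p, PF H q, (p.1 0%R + p.2 0%R = q.1 0%R + q.2 0%R)%E &
  forall v, (fun a : R =>
      a^-1 *: (pair_val p (rscale a v) - pair_val q (rscale a v)))
    @ 0^'+ --> (0 : E)].
Proof.
split=> -[pH qH pq lim]; split=> // v; apply: near_eq_cvg0 (lim v);
  by apply: filterS (sigma_wE v pH qH) => a ->.
Qed.

Lemma sigma_w_sym H p q : sigma_w H p q -> sigma_w H q p.
Proof.
move=> /sigma_wP[pH qH pq lim]; apply/sigma_wP; split=> // v.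
have h := tvl_cvgZ (c := -1) (lim v); rewrite scaler0 in h.
apply: near_eq_cvg0 (h _); apply: nearW => a.
by rewrite scaleN1r -scalerN opprB.
Qed.

Lemma sigma_w_trans H p q r : sigma_w H p q -> sigma_w H q r -> sigma_w H p r.
Proof.
move=> /sigma_wP[pH qH pq pqlim] /sigma_wP[_ rH qr qrlim].
apply/sigma_wP; split=> // [|v]; first by rewrite pq.
have h := tvl_cvgD (pqlim v) (qrlim v); rewrite addr0 in h.
by apply: near_eq_cvg0 (h _); apply: nearW => a; rewrite -scalerDr addrA subrK.
Qed.

Lemma wclass_eq H p q : sigma_w H p q -> wclass H p = wclass H q.
Proof.
move=> pq; apply/seteqP; split=> r /=; apply: sigma_w_trans => //.
exact: sigma_w_sym.
Qed.

Section AtPoint.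
Context (Omega : set X) (hOmega : open Omega) (H : set (X -> \bar E)).
Context (x : X) (hx : Omega x).
Implicit Types F : X -> E.

(** The definition speaks only of increments whose segments stay in [Omega] and in the domains.
    Every direction has a positive multiple of that kind, and rescaling recovers the limit for the
    direction itself. *)
Lemma wapproxP F p : wapprox Omega H F x p <->
  [/\ PF H p, (p.1 0%R + p.2 0%R = 0)%E & dir_approx F x (pair_val p)].
Proof.
split=> -[pH p0]; last first.
  move=> lim; split=> //.
  (* The remainder is defined as the error of the expansion, so the required equation holds as soon
     as the pair is finite at [dx]. *)
  exists (fun dx => F (x + dx) - F x - pair_val p dx) => dx _ dxp.
  split; last exact: lim.
  have /pair_valE -> : (edom p.1 `&` edom p.2) dx.
    apply: dxp; rewrite -[dx in segment _ dx]add0r -[X in segment _ _ X]add0r.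
    exact: segment_end.
  by congr (_%:E); rewrite [RHS]addrC subrK.
move=> [rem remP]; split=> // v.
have [_ _ pdom] := pH.
have xOm : nbhs x Omega by exact: open_nbhs_nbhs.
have [b [b0 bO bp]] : exists b : R, [/\ 0 < b,
    segment x (x + rscale b v) `<=` Omega &
    segment 0 (0 + rscale b v) `<=` edom p.1 `&` edom p.2].
  near (0 : R)^'+ => b; exists b; split; near: b.
  - exact: nbhs_right_gt.
  - exact: near_segment.
  - exact: near_segment.
apply: (@cvg_right0_rescale _ _ _ b) => //.
have bp0 : segment 0 (rscale b v) `<=` edom p.1 `&` edom p.2.
  by rewrite -[X in segment _ X]add0r.
have [_ lim] := remP _ bO bp0; apply: near_eq_cvg0 lim.
near=> a.
have a01 : 0 <= a <= 1.
  rewrite ltW /=; last by near: a; exact: nbhs_right_gt.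
  by near: a; exact: nbhs_right_ltW.
have segp := subset_trans (@sub_segment _ _ _ _ _ _ a01) bp.
have segp0 : segment 0 (rscale a (rscale b v)) `<=` edom p.1 `&` edom p.2.
  by rewrite -[X in segment _ X]add0r.
(* The shorter increment [a (b v)] has its segments inside those of [b v], so the expansion holds
   there too and identifies [rem] with the error along the ray. *)
have [eqo _] := remP _ (subset_trans (@sub_segment _ _ _ _ _ _ a01) bO) segp0.
have domp : (edom p.1 `&` edom p.2) (rscale a (rscale b v)).
  by rewrite -[rscale a _]add0r; apply: segp; exact: segment_end.
move: eqo; rewrite (pair_valE domp) rscaleA => -[->].
by rewrite [in RHS]addrAC subrr add0r.
Unshelve. all: by end_near.
Qed.

Lemma wapprox_unique F p q :
  wapprox Omega H F x p -> wapprox Omega H F x q -> sigma_w H p q.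
Proof.
move=> /wapproxP[pH p0 plim] /wapproxP[qH q0 qlim].
apply/sigma_wP; split=> // [|v]; first by rewrite p0 q0.
have h := tvl_cvgZ (c := -1) (plim v); rewrite scaler0 in h.
have h2 := tvl_cvgD (h _) (qlim v); rewrite addr0 in h2.
apply: near_eq_cvg0 (h2 _ _); apply: nearW => a.
by rewrite scaleN1r -scalerN -scalerDr opprB addrA subrK.
Qed.

Lemma wapprox_sigma F p q :
  wapprox Omega H F x p -> sigma_w H p q -> wapprox Omega H F x q.
Proof.
move=> /wapproxP[pH p0 plim] /sigma_wP[_ qH pq lim].
apply/wapproxP; split=> // [|v]; first by rewrite -pq.
have h := tvl_cvgD (plim v) (lim v); rewrite addr0 in h.
by apply: near_eq_cvg0 (h _); apply: nearW => a; rewrite -scalerDr addrA subrK.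
Qed.

(** The class picked by [xget] may come from another approximating pair, but by uniqueness that pair
    is equivalent to [p]. *)
Lemma wderivativeE F p :
  wapprox Omega H F x p -> wderivative Omega H F x = wclass H p.
Proof.
move=> Fp; rewrite /wderivative; set C := [set _ | _].
have [|q [Fq ->]] := @xgetPex _ set0 C; first by exists (wclass H p), p.
by apply: wclass_eq; exact: wapprox_unique Fq Fp.
Qed.

Lemma wderivative_wapprox F q : wcodifferentiable Omega H F x ->
  wderivative Omega H F x q -> wapprox Omega H F x q.
Proof.
by move=> [p Fp]; rewrite (wderivativeE Fp); exact: wapprox_sigma.
Qed.

Lemma wapprox_wderivative F p :
  wapprox Omega H F x p -> wderivative Omega H F x p.
Proof.
by move=> Fp; rewrite (wderivativeE Fp); exact: (wapprox_unique Fp Fp).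
Qed.

Lemma wclass_sets_eq P Q : admissible H P -> admissible H Q ->
  sigma_w H (psup P.1, pinf P.2) (psup Q.1, pinf Q.2) ->
  wclass_sets H P = wclass_sets H Q.
Proof.
move=> aP aQ PQ; apply/seteqP; split=> S [_ aS PS]; split=> //.
  exact: sigma_w_trans (sigma_w_sym PQ) PS.
exact: sigma_w_trans PQ PS.
Qed.

(** The generators picked by [xget] may differ from [P]. Both generate pairs that approximate [F],
    and these are equivalent by uniqueness. *)
Lemma wcodifferentialE F P : admissible H P ->
  wapprox Omega H F x (psup P.1, pinf P.2) ->
  wcodifferential Omega H F x = wclass_sets H P.
Proof.
move=> aP FP; rewrite /wcodifferential; set C := [set _ | _].
have [|Phi [Psi [U [V [FPP gU gV ->]]]]] := @xgetPex _ set0 C.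
  (* The pair [P] itself shows that there is something to pick. *)
  case: P aP FP => U V /= [U0 V0 UH VH _] FP.
  exists (wclass_sets H (U, V)), (psup U), (pinf V), U, V; split=> //.
  exact: wapprox_wderivative.
have Fp : wapprox Omega H F x (Phi, Psi).
  by apply: wderivative_wapprox => //; eexists; exact: FP.
case: gU gV => [U0 UH eU] [V0 VH eV]; rewrite eU eV in Fp.
apply: wclass_sets_eq => //; last exact: wapprox_unique Fp FP.
by split=> //; case: Fp.
Qed.

(** Lets any representative of the codifferential serve as generators of an approximating pair: the
    approximation is carried along [sigma_w]. *)
Lemma wcodifferential_wapprox F Q : wcodifferentiable Omega H F x ->
  wcodifferential Omega H F x Q ->
  admissible H Q /\ wapprox Omega H F x (psup Q.1, pinf Q.2).
Proof.
move=> [[Phi Psi] Fp]; have [[[U [U0 UH eU]] [V [V0 VH eV]] _] _ _] := Fp.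
rewrite /= in eU eV; rewrite eU eV in Fp.
have aP : admissible H (U, V) by split=> //; case: Fp.
rewrite (wcodifferentialE aP Fp) => -[_ aQ PQ]; split=> //.
exact: wapprox_sigma Fp PQ.
Qed.

End AtPoint.
End WeakDerivative.

(** * Minkowski operations on generating sets *)

Section FunctionSets.
Context (R : realType) (k : scalar_kind).
Context (X : topologicalLmodType (scalars R k)).
Context (E : topologicalVectorLatticeType R) (hEc : order_complete E).
Implicit Types (U V : set (X -> \bar E)) (h f : X -> \bar E) (v : X).

Definition opp_set U : set (X -> \bar E) := [set (\- h)%E | h in U].

Lemma opp_setK : involutive opp_set.
Proof.
move=> U; have oppK h : (\- (\- h))%E = h by apply/funext => v; exact: ext_oppK.
apply/seteqP; split=> [_ [_ [h Uh <-] <-]|h Uh]; first by rewrite oppK.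
by exists (\- h)%E; rewrite ?oppK//; exists h.
Qed.

Lemma pinf_opp U v : pinf U v = (- psup (opp_set U) v)%E.
Proof. by rewrite /pinf ext_infN// /psup !image_comp. Qed.

Lemma mink_subE U V : mink_sub U V = mink_add U (opp_set V).
Proof.
apply/seteqP; split=> f.
  by move=> [h1 [h2 [Uh1 Vh2 ->]]]; exists h1, (\- h2)%E; split=> //; exists h2.
by move=> [h1 [_ [Uh1 [h2 Vh2 <-] ->]]]; exists h1, h2.
Qed.

Lemma psup_bigcup I (W : I -> set (X -> \bar E)) :
  psup (\bigcup_i W i) = psup (range (fun i => psup (W i))).
Proof.
apply/funext => v; rewrite /psup image_bigcup ext_sup_bigcup//.
by rewrite image_comp.
Qed.

Lemma pinf_bigcup I (W : I -> set (X -> \bar E)) :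
  pinf (\bigcup_i W i) = pinf (range (fun i => pinf (W i))).
Proof.
apply/funext => v; rewrite /pinf !ext_infN// ![in LHS]image_bigcup ext_sup_bigcup//.
congr (- ext_sup _)%E; rewrite !image_comp; apply: eq_imagel => i _ /=.
by rewrite ext_infN// ext_oppK.
Qed.

Context (H : set (X -> \bar E)) (hH : H !=set0).
Context (hadd : closed_add H) (hopp : closed_opp H) (hshift : closed_shift H).

(* [h - h] has to be well defined. *)
Lemma H_finite h v : H h -> exists e : E, h v = e%:E.
Proof.
move=> Hh; have [/(_ v)[]] := hadd Hh (hopp Hh).
by case: (h v) => [e||] /= n1 n2 _; [exists e|case: n1|case: n2].
Qed.

(** Zero is [h - h] for a finite valued [h] in [H], and vertical shifts give the other constants.
    This places the singletons of constants, and the empty Minkowski sum, inside [H]. *)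
Lemma H_cst (c : E) : H (cst c%:E).
Proof.
have [h Hh] := hH; have [_ h0] := hadd Hh (hopp Hh).
have -> : cst c%:E = (fun v => (h \+ (\- h)) v + c%:E)%E; last exact: hshift.
apply/funext => v /=; have [e ->] := H_finite v Hh.
by congr (_%:E); rewrite subrr add0r.
Qed.

Definition generating U := U !=set0 /\ U `<=` H.

Lemma generating_cst (c : E) : generating [set cst c%:E].
Proof. by split; [exists (cst c%:E)|move=> _ ->; exact: H_cst]. Qed.

Lemma generating_opp U : generating U -> generating (opp_set U).
Proof.
move=> [[h Uh] UH]; split; first by exists (\- h)%E, h.
by move=> _ [f Uf <-]; apply: hopp; exact: UH.
Qed.

Lemma generating_add U V :
  generating U -> generating V -> generating (mink_add U V).
Proof.
move=> [[h Uh] UH] [[f Vf] VH]; split.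
  by exists (h \+ f)%E, h, f.
by move=> _ [h1 [h2 [/UH Hh1 /VH Hh2 ->]]]; have [] := hadd Hh1 Hh2.
Qed.

Lemma generating_sub U V :
  generating U -> generating V -> generating (mink_sub U V).
Proof.
by move=> gU gV; rewrite mink_subE; apply/generating_add/generating_opp.
Qed.

Lemma opp_set_add U V : generating U -> generating V ->
  opp_set (mink_add U V) = mink_add (opp_set U) (opp_set V).
Proof.
move=> [_ UH] [_ VH].
have oppD h f : U h -> V f -> (\- (h \+ f))%E = ((\- h) \+ (\- f))%E.
  move=> /UH Hh /VH Hf; apply/funext => v /=.
  have [a ->] := H_finite v Hh; have [b ->] := H_finite v Hf.
  exact: ext_oppD.
apply/seteqP; split=> [_ [_ [h [f [Uh Vf ->]]] <-]|].
  rewrite oppD//; exists (\- h)%E, (\- f)%E.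
  by split=> //; [exists h|exists f].
move=> _ [_ [_ [[h Uh <-] [f Vf <-] ->]]].
by exists (h \+ f)%E; [exists h, f|exact: oppD].
Qed.

(** Supplies the side condition of [ext_oppD] when a sum of infima is rewritten through suprema. *)
Lemma psup_neqNy U v : generating U -> psup U v != -oo%E.
Proof.
move=> [[h Uh] UH]; apply: ext_sup_gtNy => //; first by exists (h v), h.
by move=> _ [f /UH Hf <-]; exact: H_finite.
Qed.

(** At a fixed point, the values of the Minkowski sum are the sums of values. These are finite
    because both sets lie in [H], so [ext_supD] applies. *)
Lemma psup_add U V v : generating U -> generating V ->
  psup (mink_add U V) v = (psup U v + psup V v)%E.
Proof.
move=> [[h Uh] UH] [[f Vf] VH]; rewrite /psup -ext_supD//.
- congr ext_sup; apply/seteqP; split.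
    move=> _ [_ [h1 [h2 [Uh1 Vh2 ->]]] <-].
    by exists (h1 v); [exists h1|exists (h2 v) => //; exists h2].
  move=> _ [_ [h1 Uh1 <-] [_ [h2 Vh2 <-] <-]].
  by exists (h1 \+ h2)%E => //; exists h1, h2.
- by exists (h v), h.
- by exists (f v), f.
- by move=> _ [g /UH Hg <-]; exact: H_finite.
- by move=> _ [g /VH Hg <-]; exact: H_finite.
Qed.

Lemma pinf_add U V v : generating U -> generating V ->
  pinf (mink_add U V) v = (pinf U v + pinf V v)%E.
Proof.
move=> gU gV; rewrite !pinf_opp opp_set_add// psup_add; try exact: generating_opp.
by rewrite ext_oppD//; apply: psup_neqNy; exact: generating_opp.
Qed.

(** Subtracting the elements of [V] adds the supremum of their opposites, which is minus their
    infimum. In this way a concave part acquires generators inside a supremum. *)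
Lemma psup_sub U V v : generating U -> generating V ->
  psup (mink_sub U V) v = (psup U v - pinf V v)%E.
Proof.
move=> gU gV; rewrite mink_subE psup_add//; last exact: generating_opp.
by rewrite pinf_opp ext_oppK.
Qed.

Lemma pinf_sub U V v : generating U -> generating V ->
  pinf (mink_sub U V) v = (pinf U v - psup V v)%E.
Proof.
move=> gU gV; rewrite mink_subE pinf_add//; last exact: generating_opp.
by rewrite [pinf (opp_set V) v]pinf_opp opp_setK.
Qed.

Lemma psup_cst (c : E) v : psup [set cst c%:E] v = c%:E.
Proof. by rewrite /psup image_set1 ext_sup_eq1. Qed.

Lemma pinf_cst (c : E) v : pinf [set cst c%:E] v = c%:E.
Proof. by rewrite /pinf ext_infN// !image_set1 ext_sup_eq1 ext_oppK. Qed.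

Section FiniteSums.
Context (n : nat) (W : 'I_n -> set (X -> \bar E)).
Hypothesis gW : forall i, generating (W i).

Lemma generating_sum (P : pred 'I_n) : generating (mink_sum P W).
Proof.
rewrite /mink_sum; elim/big_ind: _ => // [|U V]; first exact: generating_cst.
exact: generating_add.
Qed.

Lemma psup_sum (P : pred 'I_n) v :
  psup (mink_sum P W) v = (\sum_(j < n | P j) psup (W j) v)%E.
Proof.
rewrite /mink_sum.
(* The induction carries generation together with the value, because [psup_add] requires it of the
   partial sum. *)
suff [] : generating (\big[@mink_add _ _ X E/[set cst 0%E]]_(j < n | P j) W j) /\
  psup (\big[@mink_add _ _ X E/[set cst 0%E]]_(j < n | P j) W j) v
  = (\sum_(j < n | P j) psup (W j) v)%E by [].
elim/big_rec2: _ => [|i s U Pi [gU <-]].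
  by split; [exact: generating_cst|exact: psup_cst].
by split; [exact: generating_add|rewrite psup_add].
Qed.

Lemma pinf_sum (P : pred 'I_n) v :
  pinf (mink_sum P W) v = (\sum_(j < n | P j) pinf (W j) v)%E.
Proof.
rewrite /mink_sum.
suff [] : generating (\big[@mink_add _ _ X E/[set cst 0%E]]_(j < n | P j) W j) /\
  pinf (\big[@mink_add _ _ X E/[set cst 0%E]]_(j < n | P j) W j) v
  = (\sum_(j < n | P j) pinf (W j) v)%E by [].
elim/big_rec2: _ => [|i s U Pi [gU <-]].
  by split; [exact: generating_cst|exact: pinf_cst].
by split; [exact: generating_add|rewrite pinf_add].
Qed.

End FiniteSums.

Section Generators.
Context (n : nat) (n_gt0 : (0 < n)%N) (c : 'I_n -> E).
Context (U V : 'I_n -> set (X -> \bar E)).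
Hypotheses (gU : forall i, generating (U i)) (gV : forall i, generating (V i)).

(** One shape for both rules: its supremum gives the convex part for the supremum of the functions,
    and with the two families exchanged its infimum gives the concave part for the infimum. *)
Let A := \bigcup_i mink_sub (mink_add [set cst (c i)%:E] (U i))
                            (mink_sum (fun j => j != i) V).

Let gA0 i : generating (mink_add [set cst (c i)%:E] (U i)).
Proof. by apply: generating_add => //; exact: generating_cst. Qed.

Lemma generating_shifted_union : generating A.
Proof.
have gA i : generating (mink_sub (mink_add [set cst (c i)%:E] (U i))
                                 (mink_sum (fun j => j != i) V)).
  by apply: generating_sub => //; exact: generating_sum.
split; last by move=> h [i _ Ah]; exact: (gA i).2.
by have [h hA] := (gA (Ordinal n_gt0)).1; exists h, (Ordinal n_gt0).
Qed.

Lemma psup_shifted_union : psup A =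
  psup (range (fun i v => (c i)%:E + psup (U i) v
                          - \sum_(j < n | j != i) pinf (V j) v)%E).
Proof.
rewrite /A psup_bigcup; congr (psup _); apply: eq_imagel => i _; apply/funext => v.
rewrite psup_sub; [|exact: gA0|exact: generating_sum].
by rewrite psup_add ?psup_cst ?pinf_sum//; exact: generating_cst.
Qed.

Lemma pinf_shifted_union : pinf A =
  pinf (range (fun i v => (c i)%:E + pinf (U i) v
                          - \sum_(j < n | j != i) psup (V j) v)%E).
Proof.
rewrite /A pinf_bigcup; congr (pinf _); apply: eq_imagel => i _; apply/funext => v.
rewrite pinf_sub; [|exact: gA0|exact: generating_sum].
by rewrite pinf_add ?pinf_cst ?psup_sum//; exact: generating_cst.
Qed.

End Generators.
End FunctionSets.

(** * Rearranging sums with finite suprema and infima in [E] *)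

Section PairValues.
Context (R : realType) (E : topologicalVectorLatticeType R).
Context (hEc : order_complete E) (n : nat) (n_gt0 : (0 < n)%N).
Implicit Types (f phi psi : 'I_n -> E) (s : E).

Lemma others_add f s i : s - (\sum_(j < n | j != i) f j) + \sum_j f j = s + f i.
Proof. by rewrite [X in _ + X](bigD1 i)//= [f i + _]addrC addrA subrK. Qed.

Lemma supremum_others f phi psi s :
  supremum 0 (range (fun i => f i - s + phi i - \sum_(j < n | j != i) psi j))
    + \sum_j psi j
  = supremum 0 (range (fun i => f i + (phi i + psi i))) - s.
Proof.
rewrite -!supremum_range_shift//; congr supremum; apply: eq_imagel => i _.
by rewrite others_add -addrA addrAC.
Qed.

Lemma infimum_others f phi psi s :
  \sum_j phi j +
    infimum 0 (range (fun i => f i - s + psi i - \sum_(j < n | j != i) phi j))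
  = infimum 0 (range (fun i => f i + (phi i + psi i))) - s.
Proof.
have shift (g : 'I_n -> E) (c : E) :
      infimum 0 (range (fun i => g i + c)) = infimum 0 (range g) + c.
  rewrite !infimum_rangeN// -[c in RHS]opprK -opprD -supremum_range_shift//.
  by under eq_fun do rewrite opprD.
rewrite addrC -!shift; congr infimum; apply: eq_imagel => i _.
by rewrite others_add -addrA [phi i + _]addrC addrAC.
Qed.

Lemma ext_inf_range_fin f :
  ext_inf (range (fun i => (f i)%:E)) = (infimum 0 (range f))%:E.
Proof.
by rewrite ext_infN// image_comp ext_sup_range_fin// infimum_rangeN.
Qed.

End PairValues.

(** * The rule for finite suprema and infima *)

Section SupremumInfimumRule.
Context (R : realType) (k : scalar_kind).
Context (X : topologicalLmodType (scalars R k)).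
Context (E : topologicalVectorLatticeType R) (hEc : order_complete E).
Context (Omega : set X) (hOmega : open Omega).
Context (H : set (X -> \bar E)) (hH : H !=set0).
Context (hadd : closed_add H) (hopp : closed_opp H) (hshift : closed_shift H).
Context (n : nat) (n_gt0 : (0 < n)%N) (F_ : 'I_n -> X -> E).
Context (x : X) (hx : Omega x).
Implicit Types (Phi Psi : 'I_n -> X -> \bar E).
Implicit Types (U V : 'I_n -> set (X -> \bar E)).

Local Notation F := (fun_sup F_).
Local Notation G := (fun_inf F_).

Definition sup_pair Phi Psi : (X -> \bar E) * (X -> \bar E) :=
  (psup (range (fun i v => (F_ i x - F x)%R%:E + Phi i v
                           - \sum_(j < n | j != i) Psi j v)%E),
   (fun v => \sum_(l < n) Psi l v)%E).

Definition inf_pair Phi Psi : (X -> \bar E) * (X -> \bar E) :=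
  ((fun v => \sum_(l < n) Phi l v)%E,
   pinf (range (fun i v => (F_ i x - G x)%R%:E + Psi i v
                           - \sum_(j < n | j != i) Phi j v)%E)).

Lemma finite_pairs Phi Psi v :
  (forall i, (edom (Phi i) `&` edom (Psi i)) v) ->
  exists phi psi : 'I_n -> E,
    (forall i, Phi i v = (phi i)%:E) /\ (forall i, Psi i v = (psi i)%:E).
Proof.
move=> dom; exists (fun i => fine (Phi i v)), (fun i => fine (Psi i v)).
by split=> i; have [[a ea] [b eb]] := dom i; rewrite ?ea ?eb.
Qed.

(** Where all the given functions are finite, the extended expressions reduce to arithmetic in [E].
    The resulting value is exactly the model of [dir_approx_sup]. *)
Lemma sup_pairE Phi Psi v : (forall i, (edom (Phi i) `&` edom (Psi i)) v) ->
  (edom (sup_pair Phi Psi).1 `&` edom (sup_pair Phi Psi).2) v /\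
  pair_val (sup_pair Phi Psi) v =
    supremum 0 (range (fun i => F_ i x + pair_val (Phi i, Psi i) v)) - F x.
Proof.
move=> /finite_pairs[phi [psi [ePhi ePsi]]].
have e1 : (sup_pair Phi Psi).1 v = (supremum 0 (range (fun i =>
    F_ i x - F x + phi i - \sum_(j < n | j != i) psi j)))%:E.
  rewrite /= /psup image_comp -ext_sup_range_fin//; congr ext_sup.
  apply: eq_imagel => i _ /=.
  by rewrite ePhi (ext_sum_fin _ ePsi).
have e2 : (sup_pair Phi Psi).2 v = (\sum_j psi j)%:E by exact: ext_sum_fin.
split; first by split; eexists; [exact: e1|exact: e2].
rewrite {1}/pair_val e1 e2 /= supremum_others//; congr (supremum _ _ - _).
by apply: eq_imagel => i _; rewrite /pair_val /= ePhi ePsi.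
Qed.

Lemma inf_pairE Phi Psi v : (forall i, (edom (Phi i) `&` edom (Psi i)) v) ->
  (edom (inf_pair Phi Psi).1 `&` edom (inf_pair Phi Psi).2) v /\
  pair_val (inf_pair Phi Psi) v =
    infimum 0 (range (fun i => F_ i x + pair_val (Phi i, Psi i) v)) - G x.
Proof.
move=> /finite_pairs[phi [psi [ePhi ePsi]]].
have e2 : (inf_pair Phi Psi).2 v = (infimum 0 (range (fun i =>
    F_ i x - G x + psi i - \sum_(j < n | j != i) phi j)))%:E.
  rewrite /= /pinf image_comp -ext_inf_range_fin//; congr ext_inf.
  apply: eq_imagel => i _ /=.
  by rewrite ePsi (ext_sum_fin _ ePhi).
have e1 : (inf_pair Phi Psi).1 v = (\sum_j phi j)%:E by exact: ext_sum_fin.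
split; first by split; eexists; [exact: e1|exact: e2].
rewrite {1}/pair_val e1 e2 /= infimum_others//; congr (infimum _ _ - _).
by apply: eq_imagel => i _; rewrite /pair_val /= ePhi ePsi.
Qed.

Section Approximation.
Context (Phi Psi : 'I_n -> X -> \bar E).
Hypothesis approx : forall i, wapprox Omega H (F_ i) x (Phi i, Psi i).

Lemma near_domains :
  \forall v \near (0 : X), forall i, (edom (Phi i) `&` edom (Psi i)) v.
Proof. by apply: filter_forall => i; have [[]] := approx i. Qed.

Lemma pair_val0 i : pair_val (Phi i, Psi i) 0 = 0.
Proof. by have [_ e0 _] := approx i; rewrite /pair_val e0. Qed.

(** Convexity and concavity are assumed here because they come from explicit generators, built
    separately. The rest follows from the values near 0. *)
Lemma sup_pair_wapprox :
  Hconvex H (sup_pair Phi Psi).1 -> Hconcave H (sup_pair Phi Psi).2 ->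
  wapprox Omega H F x (sup_pair Phi Psi).
Proof.
move=> cvx ccv; apply/wapproxP => //; split.
- by split=> //; apply: filterS near_domains => v /sup_pairE[].
- have /sup_pairE[dom0 val0] := nbhs_singleton near_domains.
  rewrite (pair_valE dom0) val0; congr (_%:E).
  (* Each pair vanishes at 0, so the supremum is that of the [F_ i x], which is [F x]. *)
  by under eq_fun do rewrite pair_val0 addr0; rewrite subrr.
- have dF i : dir_approx (F_ i) x (pair_val (Phi i, Psi i)).
    by have /(wapproxP hOmega)[] := approx i.
  apply: dir_approx_near (dir_approx_sup n_gt0 hEc dF).
  by apply: filterS near_domains => v /sup_pairE[_ ->].
Qed.

Lemma inf_pair_wapprox :
  Hconvex H (inf_pair Phi Psi).1 -> Hconcave H (inf_pair Phi Psi).2 ->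
  wapprox Omega H G x (inf_pair Phi Psi).
Proof.
move=> cvx ccv; apply/wapproxP => //; split.
- by split=> //; apply: filterS near_domains => v /inf_pairE[].
- have /inf_pairE[dom0 val0] := nbhs_singleton near_domains.
  rewrite (pair_valE dom0) val0; congr (_%:E).
  by under eq_fun do rewrite pair_val0 addr0; rewrite subrr.
- have dF i : dir_approx (F_ i) x (pair_val (Phi i, Psi i)).
    by have /(wapproxP hOmega)[] := approx i.
  apply: dir_approx_near (dir_approx_inf n_gt0 hEc dF).
  by apply: filterS near_domains => v /inf_pairE[_ ->].
Qed.

End Approximation.

Definition sup_sets U V : set (X -> \bar E) * set (X -> \bar E) :=
  (\bigcup_i mink_sub (mink_add [set cst (F_ i x - F x)%:E] (U i))
                      (mink_sum (fun j => j != i) V),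
   mink_sum xpredT V).

Definition inf_sets U V : set (X -> \bar E) * set (X -> \bar E) :=
  (mink_sum xpredT U,
   \bigcup_i mink_sub (mink_add [set cst (F_ i x - G x)%:E] (V i))
                      (mink_sum (fun j => j != i) U)).

Section Generated.
Context (U V : 'I_n -> set (X -> \bar E)).
Hypotheses (gU : forall i, generating H (U i)) (gV : forall i, generating H (V i)).
Hypothesis approx : forall i, wapprox Omega H (F_ i) x (psup (U i), pinf (V i)).

Let Phi i := psup (U i).
Let Psi i := pinf (V i).

(** The proposed sets generate the proposed functions exactly. This gives membership in [PF H] and
    links the derivative formula to the codifferential formula. *)
Lemma sup_sets_wapprox : admissible H (sup_sets U V) /\
  wapprox Omega H F x (sup_pair Phi Psi) /\
  sup_pair Phi Psi = (psup (sup_sets U V).1, pinf (sup_sets U V).2).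
Proof.
have [A0 AH] : generating H (sup_sets U V).1 by exact: generating_shifted_union.
have [B0 BH] : generating H (sup_sets U V).2 by exact: generating_sum.
have eA : (sup_pair Phi Psi).1 = psup (sup_sets U V).1.
  by rewrite (psup_shifted_union hEc hH).
have eB : (sup_pair Phi Psi).2 = pinf (sup_sets U V).2.
  by apply/funext => v; rewrite (pinf_sum hEc hH).
have eP : sup_pair Phi Psi = (psup (sup_sets U V).1, pinf (sup_sets U V).2).
  by rewrite -eA -eB.
have aP : wapprox Omega H F x (sup_pair Phi Psi).
  by apply: sup_pair_wapprox => //; eexists; split; [| |exact: eA| | |exact: eB].
by split=> //; split=> //; rewrite -eP; case: aP.
Qed.

Lemma inf_sets_wapprox : admissible H (inf_sets U V) /\
  wapprox Omega H G x (inf_pair Phi Psi) /\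
  inf_pair Phi Psi = (psup (inf_sets U V).1, pinf (inf_sets U V).2).
Proof.
have [A0 AH] : generating H (inf_sets U V).1 by exact: generating_sum.
have [B0 BH] : generating H (inf_sets U V).2 by exact: generating_shifted_union.
have eA : (inf_pair Phi Psi).1 = psup (inf_sets U V).1.
  by apply/funext => v; rewrite (psup_sum hEc hH).
have eB : (inf_pair Phi Psi).2 = pinf (inf_sets U V).2.
  by rewrite (pinf_shifted_union hEc hH).
have eP : inf_pair Phi Psi = (psup (inf_sets U V).1, pinf (inf_sets U V).2).
  by rewrite -eA -eB.
have aP : wapprox Omega H G x (inf_pair Phi Psi).
  by apply: inf_pair_wapprox => //; eexists; split; [| |exact: eA| | |exact: eB].
by split=> //; split=> //; rewrite -eP; case: aP.
Qed.

End Generated.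

(** Membership in [PF H] only asserts that generators exist for each index; choice assembles them
    into families to which the generated case applies. *)
Lemma approx_generators Phi Psi :
  (forall i, wapprox Omega H (F_ i) x (Phi i, Psi i)) ->
  exists U V : 'I_n -> set (X -> \bar E),
    [/\ forall i, generating H (U i), forall i, generating H (V i),
        Phi = fun i => psup (U i) & Psi = fun i => pinf (V i)].
Proof.
move=> approx.
have /choice[U hU] i : exists W, sup_generated H W (Phi i).
  by have [[]] := approx i.
have /choice[V hV] i : exists W, inf_generated H W (Psi i).
  by have [[]] := approx i.
exists U, V; split.
- by move=> i; have [] := hU i.
- by move=> i; have [] := hV i.
- by apply/funext => i; have [] := hU i.
- by apply/funext => i; have [] := hV i.
Qed.

Lemma sup_inf_wapprox Phi Psi :
  (forall i, wapprox Omega H (F_ i) x (Phi i, Psi i)) ->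
  wapprox Omega H F x (sup_pair Phi Psi) /\
  wapprox Omega H G x (inf_pair Phi Psi).
Proof.
move=> approx; have [U [V [gU gV ePhi ePsi]]] := approx_generators approx.
rewrite ePhi ePsi in approx *.
have [_ [? _]] := sup_sets_wapprox gU gV approx.
by have [_ [? _]] := inf_sets_wapprox gU gV approx.
Qed.

End SupremumInfimumRule.

Theorem theorem4p9 (R : realType) (k : scalar_kind)
  (X : topologicalLmodType (scalars R k))
  (E : topologicalVectorLatticeType R)
  (hX : hausdorff_space X) (hE : hausdorff_space E)
  (hEc : order_complete E)
  (Omega : set X) (hOmega : open Omega)
  (H : set (X -> \bar E)) (hH : H !=set0)
  (n : nat) (hn : (0 < n)%N) (F_ : 'I_n -> X -> E)
  (x : X) (hx : Omega x)
  (hF : forall i, wcodifferentiable Omega H (F_ i) x)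
  (hadd : closed_add H) (hopp : closed_opp H) (hshift : closed_shift H) :
  let F := fun_sup F_ in
  let G := fun_inf F_ in
  wcodifferentiable Omega H F x /\
  wcodifferentiable Omega H G x /\
  forall (Phi Psi : 'I_n -> X -> \bar E) (U V : 'I_n -> set (X -> \bar E)),
    (forall i, wderivative Omega H (F_ i) x (Phi i, Psi i)) ->
    (forall i, wcodifferential Omega H (F_ i) x (U i, V i)) ->
    [/\ wderivative Omega H F x =
          wclass H
            (psup (range (fun i v => (F_ i x - F x)%R%:E + Phi i v
                                     - \sum_(j < n | j != i) Psi j v)%E),
             (fun v => \sum_(l < n) Psi l v)%E),
        wderivative Omega H G x =
          wclass H
            ((fun v => \sum_(l < n) Phi l v)%E,
             pinf (range (fun i v => (F_ i x - G x)%R%:E + Psi i v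
                                     - \sum_(j < n | j != i) Phi j v)%E)),
        wcodifferential Omega H F x =
          wclass_sets H
            (\bigcup_i mink_sub (mink_add [set cst (F_ i x - F x)%:E] (U i))
                                (mink_sum (fun j => j != i) V),
             mink_sum xpredT V) &
        wcodifferential Omega H G x =
          wclass_sets H
            (mink_sum xpredT U,
             \bigcup_i mink_sub (mink_add [set cst (F_ i x - G x)%:E] (V i))
                                (mink_sum (fun j => j != i) U))].
Proof.
move=> F G.
(* For codifferentiability any approximating pairs will do, so they are chosen from the
   hypothesis. *)
have [q hq] := choice hF.
have approx i : wapprox Omega H (F_ i) x ((q i).1, (q i).2).
  by rewrite -surjective_pairing.
have [aF aG] := sup_inf_wapprox hEc hOmega hH hadd hopp hshift hn hx approx.
split; first by eexists; exact: aF.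
split; first by eexists; exact: aG.
move=> Phi Psi U V dF cF.
have approx2 i : wapprox Omega H (F_ i) x (Phi i, Psi i).
  exact: (wderivative_wapprox hOmega hx).
have [aF2 aG2] := sup_inf_wapprox hEc hOmega hH hadd hopp hshift hn hx approx2.
(* The sets [U i] and [V i] may generate functions other than [Phi i] and [Psi i], so they are given
   approximations of their own. *)
have adm i := wcodifferential_wapprox hOmega hx (hF i) (cF i).
have gU i : generating H (U i) by have [[]] := adm i.
have gV i : generating H (V i) by have [[]] := adm i.
have approx3 i : wapprox Omega H (F_ i) x (psup (U i), pinf (V i)).
  exact: (adm i).2.
have [admF [aF3 eF3]] :=
  sup_sets_wapprox hEc hOmega hH hadd hopp hshift hn hx gU gV approx3.
have [admG [aG3 eG3]] :=
  inf_sets_wapprox hEc hOmega hH hadd hopp hshift hn hx gU gV approx3.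
split.
- exact: wderivativeE aF2.
- exact: wderivativeE aG2.
- by apply: wcodifferentialE admF _ => //; rewrite -eF3.
- by apply: wcodifferentialE admG _ => //; rewrite -eG3.
Qed.
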